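(* Let $\Lambda$ be a semiprimary ring with finite global dimension. Then the global dimension of $\Lambda$ is attained among the injective dimensions of the simple $\Lambda$-modules whose projective cover has non-maximal Loewy length; that is, $$\mathsf{gl.dim}\,\Lambda=\max\{\mathsf{id}\,{}_\Lambda S \mid S \text{ a simple left } \Lambda\text{-module whose projective cover has non-maximal Loewy length}\}.$$
   Context: Rings are associative with unit and modules are left modules. A ring $\Lambda$ is semiprimary if $\Lambda/J(\Lambda)$ is semisimple and the Jacobson radical $J(\Lambda)$ is nilpotent. The Loewy length of a $\Lambda$-module $M$ is the least $t\ge0$ with $J(\Lambda)^tM=0$; the Loewy length of $\Lambda$ is that of the regular module. The Loewy length of a module is called maximal if it equals the Loewy length of $\Lambda$, and non-maximal otherwise. $\mathsf{id}$ denotes injective dimension and $\mathsf{gl.dim}$ the (left) global dimension. The maximum over the empty set is taken to be $0$ (this occurs, for example, if $\Lambda$ is semisimple). *)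

(* Defs.v *)
From HB Require Import structures.
From mathcomp Require Import all_boot all_order all_algebra.
From mathcomp Require Import boolp classical_sets constructive_ereal.
Set Implicit Arguments.
Unset Strict Implicit.
Unset Printing Implicit Defensive.
Import Order.TTheory GRing.Theory Num.Theory.
Local Open Scope classical_set_scope.
Local Open Scope ring_scope.

(* Dimensions and lengths are values in [\bar int]: the least natural number
   with a property, [+oo] if there is none.  In particular the zero module has
   projective and injective dimension 0. *)
Definition least (P : set nat) : \bar int :=
  match pselect (exists n, `[< P n >]) with
  | left h => (Posz (ex_minn h))%:E
  | right _ => +oo%E
  end.

(* The empty set has maximum 0. *)
Definition is_max0 (A : set (\bar int)) (m : \bar int) : Prop :=
  (A m /\ ubound A m) \/ (A = set0 /\ m = 0%E).

Section Modules.
Variable R : pzRingType.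

Definition submodule (M : lmodType R) (N : set M) : Prop :=
  N 0 /\ forall (a : R) (x y : M), N x -> N y -> N (a *: x + y).

Definition spanned (M : lmodType R) (X : set M) : set M :=
  [set x | forall N : set M, submodule N -> X `<=` N -> N x].

Definition ker (M N : lmodType R) (f : {linear M -> N}) : set M :=
  f @^-1` [set 0].

Definition simple_module (M : lmodType R) : Prop :=
  (exists x : M, x <> 0) /\
  forall N : set M, submodule N -> N = [set 0] \/ N = setT.

Definition semisimple_module (M : lmodType R) : Prop :=
  forall N : set M, submodule N ->
  exists N' : set M, [/\ submodule N', N `&` N' = [set 0]
                       & [set x + y | x in N & y in N'] = setT].

(* Left ideals are the submodules of the regular left module [R^o]. *)
Definition maximal_left_ideal (I : set R^o) : Prop :=
  [/\ submodule I, I <> setT &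
      forall I' : set R^o, submodule I' -> I `<=` I' -> I' = I \/ I' = setT].

Definition jacobson : set R^o :=
  [set a | forall I : set R^o, maximal_left_ideal I -> I a].

Definition ideal_act (I : set R^o) (M : lmodType R) (N : set M) : set M :=
  spanned [set (a : R) *: x | a in I & x in N].

Fixpoint ideal_exp (I : set R^o) (n : nat) : set R^o :=
  if n is n'.+1 then ideal_act I (ideal_exp I n') else setT.

Definition loewy_length (M : lmodType R) : \bar int :=
  least [set t | ideal_act (ideal_exp jacobson t) [set: M] = [set 0]].

Definition projective (P : lmodType R) : Prop :=
  forall (A B : lmodType R) (p : {linear A -> B}) (f : {linear P -> B}),
  range p = setT -> exists g : {linear P -> A}, forall x, p (g x) = f x.

Definition injective_module (E : lmodType R) : Prop :=
  forall (A B : lmodType R) (i : {linear A -> B}) (f : {linear A -> E}),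
  injective i -> exists g : {linear B -> E}, forall x, g (i x) = f x.

Definition projective_cover (P M : lmodType R) (p : {linear P -> M}) : Prop :=
  [/\ projective P, range p = setT &
      forall N : set P, submodule N ->
        [set x + y | x in N & y in ker p] = setT -> N = setT].

(* Exact sequences 0 -> P n -> ... -> P 0 -> M -> 0 with the P i projective,
   extended by zero modules to all degrees. *)
Definition projdim_le (M : lmodType R) (n : nat) : Prop :=
  exists (P : nat -> lmodType R) (d : forall i, {linear P i.+1 -> P i})
         (e : {linear P 0%N -> M}),
  [/\ forall i, projective (P i),
      range e = setT,
      range (d 0%N) = ker e,
      forall i, range (d i.+1) = ker (d i)
    & forall i, (n < i)%N -> forall x : P i, x = 0].

(* Dually, 0 -> M -> E 0 -> ... -> E n -> 0 with the E i injective. *)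
Definition injdim_le (M : lmodType R) (n : nat) : Prop :=
  exists (E : nat -> lmodType R) (d : forall i, {linear E i -> E i.+1})
         (e : {linear M -> E 0%N}),
  [/\ forall i, injective_module (E i),
      injective e,
      range e = ker (d 0%N),
      forall i, range (d i) = ker (d i.+1)
    & forall i, (n < i)%N -> forall x : E i, x = 0].

Definition projdim (M : lmodType R) : \bar int := least (projdim_le M).

Definition injdim (M : lmodType R) : \bar int := least (injdim_le M).

(* The supremum of the projective dimensions of all left modules. *)
Definition gldim : \bar int :=
  least [set n | forall M : lmodType R, (projdim M <= (Posz n)%:E)%E].

End Modules.

Definition semisimple_ring (S : pzRingType) : Prop := semisimple_module S^o.

(* The quotient by the Jacobson radical is given as a ring [S] with a
   surjective morphism from [R] whose kernel is the radical. *)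
Definition semiprimary (R : pzRingType) : Prop :=
  (exists (S : pzRingType) (q : {rmorphism R -> S}),
     [/\ range q = setT, q @^-1` [set 0] = @jacobson R & semisimple_ring S]) /\
  exists n, ideal_exp (@jacobson R) n = [set 0].

Definition has_nonmaximal_cover (R : pzRingType) (M : lmodType R) : Prop :=
  exists (P : lmodType R) (p : {linear P -> M}),
    projective_cover p /\ loewy_length P <> loewy_length R^o.

(* Main.v *)
Require Import Defs.
From HB Require Import structures.
From mathcomp Require Import all_boot all_order all_algebra.
From mathcomp Require Import boolp classical_sets constructive_ereal functions.
Set Implicit Arguments.
Unset Strict Implicit.
Unset Printing Implicit Defensive.
Import Order.TTheory GRing.Theory Num.Theory.
Local Open Scope classical_set_scope.
Local Open Scope ring_scope.

(** Let [J] be the radical, [L] the Loewy length of the ring and [n] its global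
    dimension.

    No injective dimension exceeds [n]: in an injective resolution of [N], the
    [n]-th cosyzygy [C] has [Ext^1(M, C) = Ext^(n+1)(M, N) = 0] for every [M]
    ([cosyzygy_injective]).  Such resolutions exist because modules embed into
    modules of additive maps from the ring to a divisible group
    ([enough_injectives]).  If [n = 0] this bound already gives the result, as
    any injective dimension is at least [0].

    Let [n > 0], and let [M] have projective dimension [n].  The end of a
    projective resolution of [M] is an exact sequence [0 -> Q -> P -> K -> 0]
    with [P] and [Q] projective and [K] not projective, and [Ext^1(K, S)] is
    [Ext^n(M, S)] for every [S] ([last_syzygy]).  If every element of [Q] in
    [J P] were in [J Q], then [Q / J Q] would be a summand of [P / J P], every
    map from [Q] to a module killed by [J] would extend to [P], and by
    successive approximation along the powers of [J] so would the identity of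
    [Q]; then [K] would be projective ([split_of_radical_inter]).  So some [x]
    in [Q] lies in [J P] but not in [J Q].

    A simple quotient [S] of [Q] in which [x] survives does the job.  The map
    from [Q] to [S] does not extend to [P], since [J] kills [S] and [x] is in
    [J P]; hence [Ext^n(M, S)] is nonzero and [S] has injective dimension [n].
    And the projective cover of [S] is [R e] for an idempotent [e] with
    [e S] nonzero; sending [e] to [e x] embeds it in [Q], as it composes with
    a lift [Q -> R e] of [Q -> S] to an automorphism.  The image of [R e] lies
    in [J P], which is killed by [J^(L-1)], so the Loewy length of the cover is
    less than [L] ([radical_projective_cover]).

    [Ext] itself is never built.  Two forms of the vanishing of [Ext^1] are
    used: extension of maps along an inclusion and lifting of maps along a
    surjection; both allow dimension shifting directly. *)

(** * Linear maps, submodules and quotients *)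

Section Maps.
Variable R : pzRingType.
Implicit Types M N A B C P K X Y : lmodType R.

Lemma linear_ex A B (f : A -> B) :
  (forall (a : R) x y, f (a *: x + y) = a *: f x + f y) ->
  exists g : {linear A -> B}, forall x, g x = f x.
Proof.
move=> hf.
pose L := GRing.isLinear.Build R A B *:%R f hf.
pose g : {linear A -> B} := HB.pack f L.
by exists g.
Qed.

(** Every map below that factors through a surjection or an injection, or that
    is defined on a sum of submodules, comes from its graph. *)
Lemma linear_of_graph A B (G : A -> B -> Prop) :
  (forall (a : R) x x' y y', G x y -> G x' y' ->
     G (a *: x + x') (a *: y + y')) ->
  (forall x, exists y, G x y) -> (forall y, G 0 y -> y = 0) ->
  exists h : {linear A -> B}, forall x, G x (h x).
Proof.
move=> Glin /choice[f Gf] G0.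
have Gfun x y y' : G x y -> G x y' -> y = y'.
  move=> h h'; apply/subr0_eq/G0.
  by have := Glin (-1) _ _ _ _ h' h; rewrite !scaleN1r addNr addrC.
have [|h hE] := @linear_ex A B f; last by exists h => x; rewrite hE.
by move=> a x y; apply: Gfun (Gf _) _; apply: Glin.
Qed.

Lemma factor_surj P M X (p : {linear P -> M}) (g : {linear P -> X}) :
  range p = setT -> ker p `<=` ker g ->
  exists h : {linear M -> X}, forall x, h (p x) = g x.
Proof.
move=> psurj kpg.
have [||_ [x x0 <-]|h hE] :=
  @linear_of_graph M X (fun m y => exists2 x, p x = m & g x = y).
- move=> a _ _ _ _ [x <- <-] [y <- <-].
  by exists (a *: x + y); rewrite linearP.
- move=> m; have : [set: M] m by [].
  by rewrite -psurj => -[x _ <-]; exists (g x), x.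
- exact: (kpg x x0).
exists h => x; have [y pE <-] := hE (p x).
apply/esym/subr0_eq; rewrite -linearB; apply: (kpg (x - y)).
by rewrite /ker/= linearB pE subrr.
Qed.

Lemma factor_inj K P X (i : {linear K -> P}) (g : {linear X -> P}) :
  injective i -> range g `<=` range i ->
  exists h : {linear X -> K}, forall x, i (h x) = g x.
Proof.
move=> iinj gi.
have [||y|h hE] := @linear_of_graph X K (fun x y => i y = g x).
- by move=> a x x' y y' e e'; rewrite !linearP e e'.
- by move=> x; have [|y _ <-] := gi (g x); [exists x|exists y].
- by rewrite linear0 => iy; apply: iinj; rewrite linear0.
by exists h.
Qed.

Section Sub.
Variables (M : lmodType R) (N : set M) (hN : submodule N).

Definition sub_carrier := {x : M | N x}.
Local Notation T := sub_carrier.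
HB.instance Definition _ := gen_eqMixin T.
HB.instance Definition _ := gen_choiceMixin T.

Lemma subm0 : N 0. Proof. by case: hN. Qed.
Lemma submD x y : N x -> N y -> N (x + y).
Proof. by move=> Nx Ny; rewrite -[x]scale1r; apply: hN.2. Qed.
Lemma submZ a x : N x -> N (a *: x).
Proof. by move=> Nx; rewrite -[_ *: _]addr0; apply: hN.2 => //; apply: subm0. Qed.
Lemma submN x : N x -> N (- x).
Proof. by move=> Nx; rewrite -scaleN1r; apply: submZ. Qed.
Lemma submB x y : N x -> N y -> N (x - y).
Proof. by move=> Nx /submN; apply: submD. Qed.

Let val_inj' (x y : T) : sval x = sval y -> x = y.
Proof. by case: x y => x hx [y hy] /= e; apply: eq_exist. Qed.

Let z : T := exist _ 0 subm0.
Let op (x : T) : T := exist _ (- sval x) (submN (svalP x)).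
Let ad (x y : T) : T := exist _ (sval x + sval y) (submD (svalP x) (svalP y)).
Let sc (a : R) (x : T) : T := exist _ (a *: sval x) (submZ a (svalP x)).

Let adA : associative ad. Proof. by move=> *; apply: val_inj'; apply: addrA. Qed.
Let adC : commutative ad. Proof. by move=> *; apply: val_inj'; apply: addrC. Qed.
Let ad0 : left_id z ad. Proof. by move=> *; apply: val_inj'; apply: add0r. Qed.
Let adN : left_inverse z op ad.
Proof. by move=> *; apply: val_inj'; apply: addNr. Qed.
HB.instance Definition _ := GRing.isZmodule.Build T adA adC ad0 adN.

Let scA a b v : sc a (sc b v) = sc (a * b) v.
Proof. by apply: val_inj'; apply: scalerA. Qed.
Let sc1 : left_id 1 sc. Proof. by move=> *; apply: val_inj'; apply: scale1r. Qed.
Let scDr : right_distributive sc +%R.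
Proof. by move=> *; apply: val_inj'; apply: scalerDr. Qed.
Let scDl v : {morph sc^~ v : a b / a + b}.
Proof. by move=> *; apply: val_inj'; apply: scalerDl. Qed.
HB.instance Definition _ := GRing.Zmodule_isLmodule.Build R T scA sc1 scDr scDl.

Lemma submodule_module : exists (K : lmodType R) (i : {linear K -> M}),
  injective i /\ range i = N.
Proof.
have [//|i iE] := @linear_ex T M sval.
exists T, i; split=> [x y|]; first by rewrite !iE; apply: val_inj'.
apply/seteqP; split=> [_ [x _ <-]|x Nx]; first by rewrite iE; apply: svalP.
by exists (exist _ x Nx) => //; rewrite iE.
Qed.

End Sub.

Section Quotient.
Variables (M : lmodType R) (N : set M) (hN : submodule N).

(** Cosets are kept as subsets of [M], so that equal classes are equal
    elements of the quotient. *)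
Definition coset_set (x : M) : set M := [set y | N (x - y)].
Definition quot_carrier := {X : set M | exists x, X = coset_set x}.
Local Notation T := quot_carrier.
HB.instance Definition _ := gen_eqMixin T.
HB.instance Definition _ := gen_choiceMixin T.

Let pi (x : M) : T := exist _ (coset_set x) (ex_intro _ x erefl).
Let rp (X : T) : M := xget 0 (sval X).

Let piE x y : N (x - y) -> pi x = pi y.
Proof.
move=> Nxy; apply: eq_exist; apply/seteqP.
split=> z; rewrite /coset_set/= => h; last first.
  by rewrite -(subrKA y x); apply: submD.
by rewrite -(subrKA x y); apply: submD => //; rewrite -opprB; apply: submN.
Qed.
Let piP x y : pi x = pi y -> N (x - y).
Proof.
move=> /(congr1 sval) /= e; have : coset_set y y.
  by rewrite /coset_set/= subrr; apply: subm0.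
by rewrite -e.
Qed.
Let rpK (X : T) : pi (rp X) = X.
Proof.
case: X => X [x XE]; apply: eq_exist; rewrite /rp/= XE.
have h : coset_set x (xget 0 (coset_set x)).
  by apply: (@xgetI _ 0 (coset_set x) x); rewrite /coset_set/= subrr; apply: subm0.
have := piE h; move/(congr1 sval) => /=; exact: esym.
Qed.
Let rpi x : N (rp (pi x) - x).
Proof. by apply: piP; rewrite rpK. Qed.

Let ad (X Y : T) : T := pi (rp X + rp Y).
Let op (X : T) : T := pi (- rp X).
Let sc (a : R) (X : T) : T := pi (a *: rp X).
Let piD x y : ad (pi x) (pi y) = pi (x + y).
Proof. by apply: piE; rewrite opprD addrACA; apply: submD. Qed.
Let piN x : op (pi x) = pi (- x).
Proof. by apply: piE; rewrite -opprD; apply: submN. Qed.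
Let piZ a x : sc a (pi x) = pi (a *: x).
Proof. by apply: piE; rewrite -scalerBr; apply: submZ. Qed.

Let adA : associative ad.
Proof.
by move=> x y z; rewrite -(rpK x) -(rpK y) -(rpK z) !piD addrA.
Qed.
Let adC : commutative ad. Proof. by move=> x y; rewrite /ad addrC. Qed.
Let ad0 : left_id (pi 0) ad.
Proof. by move=> x; rewrite -(rpK x) piD add0r. Qed.
Let adN : left_inverse (pi 0) op ad.
Proof. by move=> x; rewrite -(rpK x) piN piD addNr. Qed.
HB.instance Definition _ := GRing.isZmodule.Build T adA adC ad0 adN.

Let scA a b v : sc a (sc b v) = sc (a * b) v.
Proof. by rewrite -(rpK v) !piZ scalerA. Qed.
Let sc1 : left_id 1 sc. Proof. by move=> x; rewrite -(rpK x) piZ scale1r. Qed.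
Let scDr : right_distributive sc +%R.
Proof.
move=> a x y; rewrite -(rpK x) -(rpK y).
by rewrite [LHS](congr1 (sc a) (piD _ _)) !piZ scalerDr; apply/esym/piD.
Qed.
Let scDl v : {morph sc^~ v : a b / a + b}.
Proof.
by move=> a b; rewrite -(rpK v) !piZ scalerDl; apply/esym/piD.
Qed.
HB.instance Definition _ := GRing.Zmodule_isLmodule.Build R T scA sc1 scDr scDl.

Lemma quotient_module : exists (Q : lmodType R) (q : {linear M -> Q}),
  range q = setT /\ ker q = N.
Proof.
have [a x y|q qE] := @linear_ex M T pi.
  by rewrite -piD -piZ.
exists T, q; split; apply/seteqP; split=> // x.
- by move=> _; exists (rp x) => //; rewrite qE rpK.
- by rewrite /ker/= qE => /(piP (y := 0)); rewrite subr0.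
- by move=> Nx; rewrite /ker/= qE; apply: (piE (y := 0)); rewrite subr0.
Qed.

End Quotient.
End Maps.

(** * Divisible groups *)

Lemma zorn_above (T : Type) (B : set T) (Q : set (set T)) :
  Q B ->
  (forall F : set (set T), F !=set0 -> F `<=` Q -> total_on F subset ->
     Q (\bigcup_(X in F) X)) ->
  exists A, [/\ B `<=` A, Q A & forall C, Q C -> A `<=` C -> C `<=` A].
Proof.
move=> QB chain.
have [F FQ Ftot|A0 [QA max]] := @Zorn_bigcup T [set X | Q (B `|` X)].
  have [->|F0] := eqVneq F set0; first by rewrite /= bigcup_set0 setU0.
  have {}F0 : F !=set0 by apply/set0P.
  rewrite /=; have -> : B `|` \bigcup_(X in F) X
      = \bigcup_(Y in [set B `|` X | X in F]) Y.
    rewrite bigcup_image; apply/seteqP; split=> x.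
    - case=> [Bx|[X FX Xx]]; last by exists X => //; right.
      by have [X FX] := F0; exists X => //; left.
    - by case=> X FX [Bx|Xx]; [left|right; exists X].
  apply: chain => [|_ [X /FQ h <-] //|_ _ [X FX <-] [Y FY <-]].
    by have [X FX] := F0; exists (B `|` X), X.
  by have [XY|YX] := Ftot X Y FX FY; [left|right]; apply: setUS.
exists (B `|` A0); split=> [x Bx| |C QC AC]; [by left|exact: QA|].
apply: contrapT => nCA.
apply: (max C); last by rewrite /= setUidr // => x Bx; apply: AC; left.
split=> [x A0x|CA]; first by apply: AC; right.
by apply: nCA => x /CA; right.
Qed.

Definition divisible (D : zmodType) : Prop :=
  forall (n : nat) (d : D), (0 < n)%N -> exists d', d' *+ n = d.

Lemma int_subgroup (H : int -> Prop) :
  H 0 -> (forall m n, H m -> H n -> H (m - n)) ->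
  exists k : nat, forall n, H n <-> exists m : int, n = m * k%:Z.
Proof.
move=> H0 HB; have HN m : H m -> H (- m) by rewrite -sub0r; apply: HB.
have HM m (k : nat) : H m -> H (m *+ k).
  move=> Hm; elim: k => [|k IH]; first by rewrite mulr0n.
  by rewrite mulrS -[_ *+ k]opprK; apply/HB/HN.
have HMz m (k : int) : H m -> H (m * k).
  case: k => k Hm; first by rewrite -[Posz k]natz mulr_natr; apply: HM.
  by rewrite NegzE mulrN -[Posz _]natz mulr_natr; apply/HN/HM.
have [ex|nex] := pselect (exists k, `[< (0 < k)%N /\ H k%:Z >]); last first.
  exists 0%N => n; split=> [Hn|[m ->]]; last by rewrite mulr0.
  exists 0; rewrite mul0r; apply: contrapT => n0; apply: nex.
  exists `|n|%N; apply/asboolP; split; first by rewrite absz_gt0; apply/eqP.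
  by rewrite abszE; case: ger0P => _ //; apply: HN.
case: (ex_minnP ex) => k /asboolP[k0 Hk] kmin; exists k => n.
split=> [Hn|[m ->]]; last by rewrite mulrC; apply: HMz.
exists (n %/ k)%Z; have := divz_eq n k; set r := (n %% k)%Z => nE.
suff r0 : r = 0 by rewrite {1}nE r0 addr0.
have Hr : H r.
  have -> : r = n - k%:Z * (n %/ k)%Z by rewrite {1}nE mulrC addrC addKr.
  by apply: HB => //; apply: HMz.
have rge0 : 0 <= r by apply: modz_ge0; rewrite eqz_nat -lt0n.
have rlt : r < k%:Z by apply: ltz_pmod; rewrite ltz_nat.
case: r rge0 rlt Hr {nE} => // r _ rlt Hr; apply: contrapT => r0.
suff : (k <= r)%N by rewrite leqNgt => /negP; apply; rewrite -ltz_nat.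
apply: kmin; apply/asboolP; split=> //; rewrite lt0n; apply/eqP => rE.
by apply: r0; rewrite rE.
Qed.

Section Extension.
Variables (B D : zmodType) (Ddiv : divisible D).

Definition partial_additive (G : set (B * D)) : Prop :=
  [/\ G 0, forall u v, G u -> G v -> G (u - v) & forall d, G (0, d) -> d = 0].

Definition adjoin (G : set (B * D)) (w : B * D) : set (B * D) :=
  [set u | exists n : int, G (u - w *~ n)].

Lemma pair_mulrz (w : B * D) (n : int) : w *~ n = (w.1 *~ n, w.2 *~ n).
Proof.
apply: injective_projections.
- exact: (raddfMz fst).
- exact: (raddfMz snd).
Qed.

Lemma adjoin_partial G b d : partial_additive G ->
  (forall (n : int) d', G (b *~ n, d') -> d' = d *~ n) ->
  [/\ partial_additive (adjoin G (b, d)), G `<=` adjoin G (b, d)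
    & adjoin G (b, d) (b, d)].
Proof.
move=> [G0 GB Gf] h.
have sub : G `<=` adjoin G (b, d) by move=> u Gu; exists 0; rewrite mulr0z subr0.
split=> //; last by exists 1; rewrite mulr1z subrr.
split=> [|u v [n Gn] [m Gm]|x [n Gn]]; first exact: sub.
- exists (n - m); have := GB _ _ Gn Gm.
  by rewrite mulrzBr !opprD !opprK addrACA.
- have := GB _ _ G0 Gn; rewrite pair_mulrz sub0r opprB.
  have -> : (b *~ n, d *~ n) - (0, x) = (b *~ n, d *~ n - x).
    by apply: injective_projections; rewrite /= ?subr0.
  by move/h => e; rewrite -[x](subKr (d *~ n)) e subrr.
Qed.

(** Divisibility gives the value at a new element [b]: if [k] generates the
    integers [n] with [n b] in the domain already reached, any [d] with
    [k d] equal to the value at [k b] will do. *)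
Lemma additive_extension (G0 : set (B * D)) : partial_additive G0 ->
  exists f : B -> D, (forall x y, f (x - y) = f x - f y) /\
    forall b d, G0 (b, d) -> f b = d.
Proof.
move=> pG0.
have [F [X FX] Fp Ftot|G [G0G pG Gmax]] := zorn_above pG0.
  split=> [|u v [Y FY Yu] [Z FZ Zv]|d [Y FY Yd]].
  - by exists X => //; have [] := Fp _ FX.
  - have [YZ|ZY] := Ftot _ _ FY FZ.
    + by exists Z => //; have [_ ZB _] := Fp _ FZ; apply: ZB => //; apply: YZ.
    + by exists Y => //; have [_ YB _] := Fp _ FY; apply: YB => //; apply: ZY.
  - by have [_ _] := Fp _ FY; apply.
have [Gz GB Gf] := pG.
have GBp b d b' d' : G (b, d) -> G (b', d') -> G (b - b', d - d').
  by move=> g g'; have := GB _ _ g g'.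
have Guniq b d d' : G (b, d) -> G (b, d') -> d = d'.
  by move=> g g'; apply/subr0_eq/Gf; rewrite -(subrr b); apply: GBp.
have GM b d (n : int) : G (b, d) -> G (b *~ n, d *~ n).
  have GN c e : G (c, e) -> G (- c, - e).
    by move=> g; have := GBp 0 0 c e Gz g; rewrite !sub0r.
  move=> g; have nat_case (m : nat) : G (b *+ m, d *+ m).
    elim: m => [|m IH]; first by rewrite !mulr0n.
    by have := GBp _ _ _ _ IH (GN _ _ g); rewrite !opprK -!mulrSr.
  by case: n => n; [apply: nat_case|rewrite !NegzE !mulrNz; apply/GN/nat_case].
have tot b : exists d, G (b, d).
  have [||k kP] := @int_subgroup (fun n => exists d, G (b *~ n, d)).
  - by exists 0; rewrite mulr0z.
  - by move=> m n [d g] [d' g']; exists (d - d'); rewrite mulrzBr; apply: GBp.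
  have [d dP] : exists d, forall (n : int) d', G (b *~ n, d') -> d' = d *~ n.
    have [k0|k0] := posnP k.
      exists 0 => n d' g.
      have [m nE] : exists m : int, n = m * k%:Z by apply/kP; exists d'.
      by move: g; rewrite nE k0 mulr0 mulr0z => /Gf ->; rewrite mul0rz.
    have [d1 g1] : exists d, G (b *~ k%:Z, d) by apply/kP; exists 1; rewrite mul1r.
    have [d dE] := Ddiv d1 k0; exists d => n d' g.
    have [m nE] : exists m : int, n = m * k%:Z by apply/kP; exists d'.
    apply: Guniq g _; rewrite nE mulrC !mulrzA.
    by rewrite [d *~ k%:Z](_ : _ = d1); [apply: GM|rewrite -pmulrn].
  have [pG' GG' bG'] := adjoin_partial pG dP.
  by exists d; apply: Gmax GG' _ bG'.
have [f fP] := choice tot; exists f; split=> [x y|b d /G0G g].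
- by apply: Guniq (fP _) _; apply: GBp.
- exact: Guniq (fP _) g.
Qed.
End Extension.

Lemma divisible_torsion : exists D : zmodType, divisible D /\
  forall k : nat, k <> 1%N -> exists d : D, d <> 0 /\ d *+ k = 0.
Proof.
pose N : set (zmodule rat) := [set x | exists n : int, x = n%:~R :> rat].
have hN : submodule N.
  split=> [|a x y [m ->] [n ->]]; first by exists 0.
  by exists (m * a + n); rewrite intrD mulrzA.
have [D [q [qsurj qker]]] := quotient_module hN.
have q0 x : q x = 0 <-> N x by rewrite -qker.
have qM x n : q (x *+ n) = q x *+ n by rewrite raddfMn.
exists D; split=> [n d n0|k k1].
  have : [set: D] d by []; rewrite -qsurj => -[x _ <-].
  exists (q (x / n%:R : rat)); rewrite -qM; congr (q _).
  by rewrite -[_ *+ n]mulr_natr divfK // pnatr_eq0 -lt0n.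
pose c := (if k is 0 then 2 else k)%N.
have c1 : (1 < c)%N by rewrite {}/c; case: k k1 => [|[]].
have c0 : c%:R != 0 :> rat by rewrite pnatr_eq0 -lt0n ltnW.
exists (q (c%:R^-1 : rat)); split.
  move/q0 => [n nE]; have : (n * c%:Z)%:~R = 1 :> rat.
    by rewrite intrM -nE pmulrn mulVf.
  move/eqP; rewrite (eqr_int _ _ 1) => /eqP/(congr1 absz).
  by rewrite abszM /= => /eqP; rewrite muln_eq1 => /andP[_ /eqP cE]; rewrite cE in c1.
rewrite -qM; apply/q0; rewrite /c; case: (k) => [|j]; first by exists 0.
by exists 1; rewrite -[_ *+ _]mulr_natr mulVf // pnatr_eq0.
Qed.

Lemma divisible_embedding (M : zmodType) : exists (D : zmodType) (f : M -> D),
  [/\ divisible D, forall x y, f (x - y) = f x - f y & injective f].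
Proof.
have [D [Ddiv Dtor]] := divisible_torsion.
have chi m : exists f : M -> D,
    (forall x y, f (x - y) = f x - f y) /\ (m <> 0 -> f m <> 0).
  have [->|/eqP m0] := eqVneq m 0.
    by exists (fun=> 0); split=> // x y; rewrite subrr.
  have [||k kP] := @int_subgroup (fun n => m *~ n = 0).
  - by rewrite mulr0z.
  - by move=> i j hi hj; rewrite mulrzBr hi hj subrr.
  have k1 : k <> 1%N.
    move=> kE; apply: m0; have := (kP 1).2; rewrite mulr1z; apply.
    by exists 1; rewrite kE mulr1.
  have [d [d0 dk]] := Dtor k k1.
  pose Z : set (M * D) := [set u | u = 0].
  have pZ : partial_additive Z.
    by split=> // [u v -> ->|x [-> //]]; rewrite /Z/= subrr.
  have [n d' [mn ->]|pG _ Gw] := @adjoin_partial _ _ Z m d pZ.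
    have /kP[j ->] := mn.
    by rewrite mulrC mulrzA -pmulrn dk mul0rz.
  have [f [fB fG]] := additive_extension Ddiv pG.
  by exists f; split=> // _; rewrite (fG _ _ Gw).
have [f fP] := choice chi.
exists (M -> D), (fun x m => f m x); split.
- move=> n d n0; have [d' d'E] := choice (fun m => Ddiv n (d m) n0).
  exists d'; apply/funext => m; rewrite -[RHS]d'E.
  by elim: (n) => [|j IH]; rewrite ?mulr0n // !mulrS -IH.
- by move=> x y; apply/funext => m; rewrite (fP m).1.
- move=> x y /(congr1 (fun g => g (x - y))) /= e.
  apply/subr0_eq; apply: contrapT => /(fP (x - y)).2; apply.
  by rewrite (fP _).1 e subrr.
Qed.

(** * Enough injectives *)

Lemma additiveD (A D : zmodType) (f : A -> D) :
  (forall x y, f (x - y) = f x - f y) -> forall x y, f (x + y) = f x + f y.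
Proof.
move=> fB x y; have f0 : f 0 = 0 by have := fB 0 0; rewrite !subrr.
have fN : f (- y) = - f y by rewrite -sub0r fB f0 sub0r.
by rewrite -[y in LHS]opprK fB fN opprK.
Qed.

Section Coinduced.
Variables (R : pzRingType) (D : zmodType).

(** The module of additive maps from [R] to [D], with [R] acting through right
    multiplication on the source. *)
Definition coinduced :=
  {h : R -> D | forall x y, h (x - y) = h x - h y}.
Local Notation T := coinduced.
HB.instance Definition _ := gen_eqMixin T.
HB.instance Definition _ := gen_choiceMixin T.

Let ext (x y : T) : (forall s, sval x s = sval y s) -> x = y.
Proof. by case: x y => x hx [y hy] /= /funext e; apply: eq_exist. Qed.

Let z : T.
Proof. by exists (fun=> 0) => x y; rewrite subrr. Defined.
Let op (h : T) : T.
Proof. by exists (fun s => - sval h s) => x y; rewrite (svalP h) opprD. Defined.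
Let ad (g h : T) : T.
Proof.
exists (fun s => sval g s + sval h s) => x y.
by rewrite (svalP g) (svalP h) opprD addrACA.
Defined.
Let sc (a : R) (h : T) : T.
Proof. by exists (fun s => sval h (s * a)) => x y; rewrite mulrBl (svalP h). Defined.

Let adA : associative ad. Proof. by move=> *; apply: ext => s; apply: addrA. Qed.
Let adC : commutative ad. Proof. by move=> *; apply: ext => s; apply: addrC. Qed.
Let ad0 : left_id z ad. Proof. by move=> *; apply: ext => s; apply: add0r. Qed.
Let adN : left_inverse z op ad.
Proof. by move=> *; apply: ext => s; apply: addNr. Qed.
HB.instance Definition _ := GRing.isZmodule.Build T adA adC ad0 adN.

Let scA a b v : sc a (sc b v) = sc (a * b) v.
Proof. by apply: ext => s /=; rewrite mulrA. Qed.
Let sc1 : left_id 1 sc. Proof. by move=> h; apply: ext => s /=; rewrite mulr1. Qed.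
Let scDr : right_distributive sc +%R.
Proof. by move=> *; apply: ext => s. Qed.
Let addE (h : T) x y : sval h (x + y) = sval h x + sval h y.
Proof.
exact: (additiveD (svalP h)).
Qed.
Let scDl v : {morph sc^~ v : a b / a + b}.
Proof. by move=> a b; apply: ext => s /=; rewrite mulrDr addE. Qed.
HB.instance Definition _ := GRing.Zmodule_isLmodule.Build R T scA sc1 scDr scDl.

(** Linear maps to the coinduced module are additive maps to [D], through
    evaluation at [1], so they extend along injections when [D] is
    divisible. *)
Lemma coinduced_hom (A : lmodType R) (f : A -> D) :
  (forall x y, f (x - y) = f x - f y) ->
  exists g : {linear A -> T}, forall x s, sval (g x) s = f (s *: x).
Proof.
move=> fB.
have fh x : exists h : T, forall s, sval h s = f (s *: x).
  have hB u v : f ((u - v) *: x) = f (u *: x) - f (v *: x).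
    by rewrite scalerBl fB.
  by exists (exist _ (fun s => f (s *: x)) hB).
have fD := additiveD fB.
have [h hE] := choice fh.
have [a x y|g gE] := @linear_ex R A T h.
  by apply: ext => s; rewrite hE scalerDr fD scalerA /= !hE.
by exists g => x s; rewrite gE.
Qed.

Lemma coinduced_injective : divisible D -> injective_module (T : lmodType R).
Proof.
move=> Ddiv A B i f iinj.
pose G : set (B * D) := [set u | exists a, u = (i a, sval (f a) 1)].
have pG : partial_additive G.
  split=> [|_ _ [a ->] [b ->]|d [a [a0 ->]]].
  - by exists 0; rewrite !linear0.
  - by exists (a - b); rewrite !linearB.
  - have -> : a = 0 by apply: iinj; rewrite linear0.
    by rewrite linear0.
have [h [hB hG]] := additive_extension Ddiv pG.
have [g gE] := coinduced_hom hB.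
exists g => a; apply: ext => s; rewrite gE -linearZ.
have -> : h (i (s *: a)) = sval (f (s *: a)) 1 by apply: hG; exists (s *: a).
by rewrite linearZ /= mul1r.
Qed.
End Coinduced.

Lemma enough_injectives (R : pzRingType) (M : lmodType R) :
  exists (E : lmodType R) (i : {linear M -> E}), injective i /\ injective_module E.
Proof.
have [D [f [Ddiv fB finj]]] := divisible_embedding M.
have [g gE] := coinduced_hom fB.
exists (coinduced R D : lmodType R), g.
split=> [x y e|]; last exact: coinduced_injective.
by apply: finj; rewrite -[x]scale1r -[y]scale1r -!gE e.
Qed.

(** * Extensions and dimension shifting *)

Section Homological.
Variable R : pzRingType.
Implicit Types M N A B C D E P K Q X Y S : lmodType R.

Definition short_exact K P M (i : {linear K -> P}) (p : {linear P -> M}) : Prop :=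
  [/\ injective i, range p = setT & range i = ker p].

Lemma short_exact0 K P M (i : {linear K -> P}) (p : {linear P -> M}) x :
  short_exact i p -> p (i x) = 0.
Proof. by move=> [_ _ ik]; have : range i (i x); [exists x|rewrite ik]. Qed.

Lemma surj_ex A B (p : {linear A -> B}) y : range p = setT -> exists x, p x = y.
Proof. by move=> ps; have : [set: B] y by []; rewrite -ps => -[x _ <-]; exists x. Qed.

Lemma kernel_ex P M (p : {linear P -> M}) : range p = setT ->
  exists K (i : {linear K -> P}), short_exact i p.
Proof.
move=> psurj; have hk : submodule (ker p).
  split=> [|a x y]; first exact: linear0.
  by rewrite /ker/= linearP => -> ->; rewrite scaler0 addr0.
by have [K [i [iinj ik]]] := submodule_module hk; exists K, i.
Qed.

Lemma cokernel_ex A B (i : {linear A -> B}) : injective i ->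
  exists M (p : {linear B -> M}), short_exact i p.
Proof.
move=> iinj; have hi : submodule (range i).
  split=> [|a _ _ [x _ <-] [y _ <-]]; first by exists 0; rewrite ?linear0.
  by exists (a *: x + y); rewrite ?linearP.
by have [M [p [ps pk]]] := quotient_module hi; exists M, p.
Qed.

(** [ext_extends M C] and [ext_lifts M C] are two forms of the vanishing of
    [Ext^1(M, C)]. *)
Definition ext_extends M C : Prop :=
  forall A B (i : {linear A -> B}) (p : {linear B -> M}), short_exact i p ->
  forall f : {linear A -> C}, exists g : {linear B -> C}, forall x, g (i x) = f x.

Definition ext_lifts M C : Prop :=
  forall X Y (j : {linear C -> X}) (q : {linear X -> Y}), short_exact j q ->
  forall g : {linear M -> Y}, exists h : {linear M -> X}, forall x, q (h x) = g x.

Lemma ext_lifts_of_projective K P M C (i : {linear K -> P}) (p : {linear P -> M}) :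
  short_exact i p -> projective P ->
  (forall f : {linear K -> C}, exists g : {linear P -> C}, forall x, g (i x) = f x) ->
  ext_lifts M C.
Proof.
move=> sip; have [_ ps ik] := sip.
move=> Pproj Cext X Y j q sjq g; have [_ qs jk] := sjq.
have [phi phiE] := Pproj _ _ q (g \o p) qs.
have [|psi psiE] := @factor_inj _ _ _ _ j (phi \o i) (let: And3 h _ _ := sjq in h).
  by move=> _ [x _ <-]; rewrite jk /ker/= phiE /= (short_exact0 _ sip) linear0.
have [h hE] := Cext psi.
have [|u uE] := @factor_surj _ _ _ _ p (phi \- (j \o h)) ps.
  by move=> x; rewrite -ik => -[y _ <-]; rewrite /ker/= hE psiE /= subrr.
exists u => m; have [x <-] := surj_ex m ps.
by rewrite uE /= linearB phiE /= (short_exact0 _ sjq) subr0.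
Qed.

Lemma ext_extends_of_injective M C E Y (j : {linear C -> E}) (q : {linear E -> Y}) :
  short_exact j q -> injective_module E ->
  (forall g : {linear M -> Y}, exists h : {linear M -> E}, forall x, q (h x) = g x) ->
  ext_extends M C.
Proof.
move=> sjq; have [jinj _ jk] := sjq.
move=> Einj Mlift A B i p sip f; have [iinj ps ik] := sip.
have [phi phiE] := Einj _ _ i (j \o f) iinj.
have [|u uE] := @factor_surj _ _ _ _ p (q \o phi) ps.
  by move=> x; rewrite -ik => -[y _ <-]; rewrite /ker/= phiE /= (short_exact0 _ sjq).
have [v vE] := Mlift u.
have [|h hE] := @factor_inj _ _ _ _ j (phi \- (v \o p)) jinj.
  by move=> _ [x _ <-]; rewrite jk /ker/= linearB vE uE subrr.
exists h => a; apply: jinj.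
by rewrite hE /= phiE /= (short_exact0 _ sip) linear0 subr0.
Qed.

(** Both shifts express [Ext^1(K, N) = Ext^2(M, N) = Ext^1(M, C)]: a map
    [K -> C] extends to [P] if and only if it lifts to [E]. *)
Lemma ext_extends_shift K P M N E C (i : {linear K -> P}) (p : {linear P -> M})
    (j : {linear N -> E}) (q : {linear E -> C}) :
  short_exact i p -> projective P -> short_exact j q -> injective_module E ->
  ext_extends M C -> ext_extends K N.
Proof.
move=> sip Pproj sjq Einj MC; apply: (ext_extends_of_injective sjq Einj) => g.
have [g' g'E] := MC _ _ _ _ sip g.
have [h hE] := Pproj _ _ q g' (let: And3 _ h _ := sjq in h).
by exists (h \o i) => x; rewrite /= hE g'E.
Qed.

Lemma ext_lifts_shift K P M N E C (i : {linear K -> P}) (p : {linear P -> M})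
    (j : {linear N -> E}) (q : {linear E -> C}) :
  short_exact i p -> projective P -> short_exact j q -> injective_module E ->
  ext_lifts K N -> ext_lifts M C.
Proof.
move=> sip Pproj sjq Einj KN; apply: (ext_lifts_of_projective sip Pproj) => f.
have [f' f'E] := KN _ _ _ _ sjq f.
have [h hE] := Einj _ _ i f' (let: And3 h _ _ := sip in h).
by exists (q \o h) => x; rewrite /= hE f'E.
Qed.

(** * Resolutions of bounded length *)

Fixpoint pd_le M (n : nat) : Prop :=
  if n is n'.+1 then
    exists P K (i : {linear K -> P}) (p : {linear P -> M}),
      [/\ projective P, short_exact i p & pd_le K n']
  else projective M.

Inductive cosyzygy N : nat -> lmodType R -> Prop :=
| Cosyzygy0 : cosyzygy N 0 N
| CosyzygyS n C E D (j : {linear C -> E}) (q : {linear E -> D}) of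
    cosyzygy N n C & injective_module E & short_exact j q : cosyzygy N n.+1 D.

Lemma cosyzygy_prepend N E C n D (j : {linear N -> E}) (q : {linear E -> C}) :
  short_exact j q -> injective_module E -> cosyzygy C n D -> cosyzygy N n.+1 D.
Proof.
move=> sjq Einj; elim=> [|m C' E' D' j' q' _ IH Einj' sjq'].
  exact: CosyzygyS (Cosyzygy0 N) Einj sjq.
exact: CosyzygyS IH Einj' sjq'.
Qed.

Lemma cosyzygy_ex N n : exists C, cosyzygy N n C.
Proof.
elim: n => [|n [C NC]]; first by exists N; apply: Cosyzygy0.
have [E [j [jinj Einj]]] := enough_injectives C.
have [D [q sjq]] := cokernel_ex jinj.
by exists D; apply: CosyzygyS NC Einj sjq.
Qed.

Lemma projective_retract M P (s : {linear M -> P}) (r : {linear P -> M}) :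
  projective P -> (forall x, r (s x) = x) -> projective M.
Proof.
move=> Pproj rs A B p f ps; have [g gE] := Pproj _ _ p (f \o r) ps.
by exists (g \o s) => x; rewrite /= gE /= rs.
Qed.

Lemma injective_retract M E (s : {linear M -> E}) (r : {linear E -> M}) :
  injective_module E -> (forall x, r (s x) = x) -> injective_module M.
Proof.
move=> Einj rs A B i f ii; have [g gE] := Einj _ _ i (s \o f) ii.
by exists (r \o g) => x; rewrite /= gE /= rs.
Qed.

Lemma zero_projective M : (forall x : M, x = 0) -> projective M.
Proof.
move=> M0 A B p f ps.
have [|g _] := @linear_ex R M A (fun=> 0).
  by move=> a x y; rewrite scaler0 addr0.
by exists g => x; rewrite (M0 x) !linear0.
Qed.

Lemma zero_injective M : (forall x : M, x = 0) -> injective_module M.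
Proof.
move=> M0 A B i f ii.
have [|g _] := @linear_ex R B M (fun=> 0).
  by move=> a x y; rewrite scaler0 addr0.
by exists g => x; rewrite [LHS]M0 [RHS]M0.
Qed.

Lemma projective_iso M N (f : {linear M -> N}) :
  injective f -> range f = setT -> projective M -> projective N.
Proof.
move=> finj fs Mproj.
have [|g gE] := @factor_inj _ _ _ _ f (idfun : {linear N -> N}) finj; first by rewrite fs.
by apply: (@projective_retract N M g f).
Qed.

Lemma injective_iso M N (f : {linear M -> N}) :
  injective f -> range f = setT -> injective_module N -> injective_module M.
Proof.
move=> finj fs Ninj.
have [|g gE] := @factor_inj _ _ _ _ f (idfun : {linear N -> N}) finj; first by rewrite fs.
by apply: (@injective_retract M N f g) => // x; apply: finj; rewrite gE.
Qed.

(** With [n]-step projective resolutions for all modules, the [n]-th cosyzygy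
    [C] satisfies [Ext^1(M, C) = 0] for all [M], and so splits off from any
    injective module around it. *)
Lemma cosyzygy_injective n N C :
  (forall M, pd_le M n) -> cosyzygy N n C -> injective_module C.
Proof.
move=> pdn NC.
have CL M : ext_lifts M C.
  elim: NC M (pdn M) => [|m C' E D j q _ IH Einj sjq] M /=.
    by move=> Mproj X Y j q [_ qs _] g; apply: Mproj.
  by move=> [P [K [i [p [Pproj sip /IH KC]]]]]; apply: ext_lifts_shift sip Pproj sjq Einj KC.
have [E [j [jinj Einj]]] := enough_injectives C.
have [D [q sjq]] := cokernel_ex jinj; have [_ qs jk] := sjq.
have [s sE] := CL D _ _ _ _ sjq idfun.
have [|r rE] := @factor_inj _ _ _ _ j (idfun \- (s \o q)) jinj.
  by move=> _ [x _ <-]; rewrite jk /ker/= linearB sE subrr.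
apply: (@injective_retract C E j r Einj) => x.
by apply: jinj; rewrite rE /= (short_exact0 _ sjq) linear0 subr0.
Qed.

(** [K] is the [n]-th syzygy of [M] in a resolution of minimal length.  The
    last clause is [n] dimension shifts: [Ext^1(K, S)] and [Ext^1(M, C)] are
    both [Ext^(n+1)(M, S)]. *)
Lemma last_syzygy n M : pd_le M n.+1 -> ~ pd_le M n ->
  exists Q P K (i : {linear Q -> P}) (p : {linear P -> K}),
    [/\ projective Q, projective P, short_exact i p, ~ projective K
      & forall S C, cosyzygy S n C -> ext_extends M C -> ext_extends K S].
Proof.
elim: n M => [|n IH] M.
  move=> [P [Q [i [p [Pproj sip Qproj]]]]] Mnproj; exists Q, P, M, i, p; split=> // S C h.
  by inversion h.
move=> [P1 [K1 [i1 [p1 [P1proj s1 pdK1]]]]] npd.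
have [|Q [P [K [i [p [Qproj Pproj sip Knproj h]]]]]] := IH K1 pdK1.
  by move=> pdK1'; apply: npd; exists P1, K1, i1, p1.
exists Q, P, K, i, p; split=> // S C SC MC.
inversion SC as [|m C' E D j q SC' Einj sjq e1 e2]; subst.
by apply: h SC' _; apply: ext_extends_shift s1 P1proj sjq Einj MC.
Qed.

Lemma projdim_le_pd M n : projdim_le M n -> pd_le M n.
Proof.
elim: n M => [|n IH] M [P [d [e [Pproj es de dd P0]]]] /=.
  apply: projective_iso es (Pproj 0%N) => x y exy; apply/subr0_eq.
  have : ker e (x - y) by rewrite /ker/= linearB exy subrr.
  by rewrite -de => -[z _ <-]; rewrite (P0 1%N _ z) ?linear0.
have [K [i sie]] := kernel_ex es; have [iinj _ ik] := sie.
exists (P 0%N), K, i, e; split=> //; apply: IH.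
have [|e' e'E] := @factor_inj _ _ _ _ i (d 0%N) iinj.
  by rewrite ik de.
exists (fun k => P k.+1), (fun k => d k.+1), e'; split=> [k|||k|k nk x].
- exact: Pproj.
- apply/seteqP; split=> // y _.
  have : range i (i y) by exists y.
  by rewrite ik -de => -[x _ dx]; exists x => //; apply: iinj; rewrite e'E.
- rewrite dd; apply/seteqP; split=> x; rewrite /ker/= => hx.
    by apply: iinj; rewrite e'E hx linear0.
  by rewrite -e'E hx linear0.
- exact: dd.
- exact: P0.
Qed.

Let zero : lmodType R := 'rV[R]_0.
Let zero0 (x : zero) : x = 0.
Proof. exact: thinmx0. Qed.

Lemma pd_projdim_le M n : pd_le M n -> projdim_le M n.
Proof.
elim: n M => [|n IH] M /=.
  move=> Mproj.
  pose P k : lmodType R := if k is 0 then M else zero.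
  exists P, (fun k => \0 : {linear P k.+1 -> P k}), (idfun : {linear M -> M}).
  have Z k (x : P k.+1) : x = 0 by apply: zero0.
  split=> [k||| k |[//|k] _ x].
  - by case: k => [|k] //=; apply: zero_projective.
  - by apply/seteqP; split=> // x _; exists x.
  - apply/seteqP; split=> [_ [x _ <-] //|x]; rewrite /ker/= => ->.
    by exists 0.
  - by apply/seteqP; split=> [_ [x _ <-] //|x _]; exists 0 => //; rewrite (Z _ x).
  - exact: Z.
move=> [P0 [K [i [p [P0proj sip /IH [P [d [e [Pproj es de dd Pz]]]]]]]]].
have [iinj ps ik] := sip.
pose P' k : lmodType R := if k is k'.+1 then P k' else P0.
pose d' k : {linear P' k.+1 -> P' k} :=
  match k return {linear P' k.+1 -> P' k} with
  | 0 => i \o e | k'.+1 => d k' end.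
exists P', d', p; split=> [[|k]|||[|k]|[//|k] nk x] //=.
- rewrite -ik; apply/seteqP; split=> [_ [x _ <-]|_ [y _ <-]]; first by exists (e x).
  by have [x <-] := surj_ex y es; exists x.
- rewrite de; apply/seteqP; split=> x; rewrite /ker/= => hx; first by rewrite hx linear0.
  by apply: iinj; rewrite hx linear0.
- exact: dd.
- exact: (Pz k nk x).
Qed.

Lemma injdim_le_cosyzygy M n : injdim_le M n ->
  exists C, cosyzygy M n C /\ injective_module C.
Proof.
elim: n M => [|n IH] M [E [d [e [Einj einj de dd E0]]]] /=.
  exists M; split; first exact: Cosyzygy0.
  apply: injective_iso einj _ (Einj 0%N).
  by rewrite de; apply/seteqP; split=> // x _; apply: E0.
have [C [q seq]] := cokernel_ex einj; have [_ qs ek] := seq.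
have [|e' e'E] := @factor_surj _ _ _ _ q (d 0%N) qs.
  by rewrite -ek de.
have [|D [CD Dinj]] := IH C; last first.
  by exists D; split=> //; apply: cosyzygy_prepend seq (Einj 0%N) CD.
exists (fun k => E k.+1), (fun k => d k.+1), e'; split=> [k|x y||k|k nk x].
- exact: Einj.
- have [a <-] := surj_ex x qs; have [b <-] := surj_ex y qs.
  rewrite !e'E => dab; apply/subr0_eq; rewrite -linearB.
  have : ker (d 0%N) (a - b) by rewrite /ker/= linearB dab subrr.
  by rewrite -de ek.
- rewrite -dd; apply/seteqP; split=> [_ [c _ <-]|_ [x _ <-]].
    by have [x <-] := surj_ex c qs; exists x.
  by exists (q x).
- exact: dd.
- exact: E0.
Qed.

Lemma injective_injdim_le M : injective_module M -> injdim_le M 0.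
Proof.
move=> Minj; pose E k : lmodType R := if k is 0 then M else zero.
exists E, (fun k => \0 : {linear E k -> E k.+1}), (idfun : {linear M -> M}).
have Z k (x : E k.+1) : x = 0 by apply: zero0.
split=> [k||| k |[//|k] _ x].
- by case: k => [|k] //=; apply: zero_injective.
- by move=> x y.
- by apply/seteqP; split=> // x _; exists x.
- by apply/seteqP; split=> [_ [x _ <-] //|x _]; exists 0 => //; rewrite (Z _ x).
- exact: Z.
Qed.

Lemma injdim_le_prepend N E0 C n (j : {linear N -> E0}) (q : {linear E0 -> C}) :
  short_exact j q -> injective_module E0 -> injdim_le C n -> injdim_le N n.+1.
Proof.
move=> [jinj qs jk] E0inj [E [d [e [Einj einj de dd Ez]]]].
pose E' k : lmodType R := if k is k'.+1 then E k' else E0.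
pose d' k : {linear E' k -> E' k.+1} :=
  match k return {linear E' k -> E' k.+1} with
  | 0 => e \o q | k'.+1 => d k' end.
exists E', d', j; split=> [[|k]|||[|k]|[//|k] nk x] //=.
- rewrite jk; apply/seteqP; split=> x; rewrite /ker/= => hx; first by rewrite hx linear0.
  by apply: einj; rewrite hx linear0.
- rewrite -de; apply/seteqP; split=> [_ [x _ <-]|_ [y _ <-]]; first by exists (q x).
  by have [x <-] := surj_ex y qs; exists x.
- exact: dd.
- exact: (Ez k nk x).
Qed.

Lemma cosyzygy_injdim_le M n C m :
  cosyzygy M n C -> injdim_le C m -> injdim_le M (n + m).
Proof.
move=> MC; elim: MC m => [//|k C' E D j q _ IH Einj sjq] m Dm.
by rewrite addSnnS; apply: IH; apply: injdim_le_prepend sjq Einj Dm.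
Qed.
End Homological.

Section Least.
Implicit Types P : set nat.

Lemma least_le P m : P m -> (least P <= m%:Z%:E)%E.
Proof.
move=> Pm; rewrite /least; case: pselect => [h|[]]; last by exists m; apply/asboolP.
case: ex_minnP => k _ kmin; rewrite lee_fin lez_nat.
by apply: kmin; apply/asboolP.
Qed.

Lemma least_fin P (x : \bar int) : (least P <= x)%E -> (x < +oo)%E ->
  exists m : nat, [/\ least P = m%:Z%:E, P m & forall k, P k -> (m <= k)%N].
Proof.
rewrite /least; case: pselect => [h _ _|h]; last by case: x.
case: ex_minnP => k /asboolP Pk kmin; exists k; split=> // j Pj.
by apply: kmin; apply/asboolP.
Qed.

Lemma leastP P n : (least P <= n%:Z%:E)%E -> exists2 m, (m <= n)%N & P m.
Proof.
move=> le; have [|m [mE Pm _]] := least_fin le; first by rewrite ltry.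
by exists m => //; move: le; rewrite mE lee_fin lez_nat.
Qed.

Lemma least_eq P n : P n -> (forall k, P k -> (n <= k)%N) -> least P = n%:Z%:E.
Proof.
move=> Pn min; have le := least_le Pn.
have [|m [-> Pm /(_ n Pn) mn]] := least_fin le; first by rewrite ltry.
by congr (_%:Z%:E); apply/eqP; rewrite eqn_leq mn min.
Qed.
End Least.

Lemma projdim_le_mono (R : pzRingType) (M : lmodType R) m n :
  (m <= n)%N -> projdim_le M m -> projdim_le M n.
Proof.
move=> mn [P [d [e [? ? ? ? P0]]]]; exists P, d, e; split=> // i ni.
exact/P0/(leq_ltn_trans mn).
Qed.

Lemma injdim_le_mono (R : pzRingType) (M : lmodType R) m n :
  (m <= n)%N -> injdim_le M m -> injdim_le M n.
Proof.
move=> mn [E [d [e [? ? ? ? E0]]]]; exists E, d, e; split=> // i ni.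
exact/E0/(leq_ltn_trans mn).
Qed.

(** * The radical filtration *)

Section Span.
Variable R : pzRingType.
Implicit Types (M N : lmodType R) (I : set R^o).

Lemma submodule0 M : submodule [set 0 : M].
Proof. by split=> // a x y /= -> ->; rewrite scaler0 addr0. Qed.

Lemma spanned_submodule M (X : set M) : submodule (spanned X).
Proof.
split=> [N [] //|a x y hx hy N hN XN].
by apply: hN.2; [apply: hx|apply: hy].
Qed.

Lemma ideal_act_submodule I M (N : set M) : submodule (ideal_act I N).
Proof. exact: spanned_submodule. Qed.

Lemma ideal_actI I M (N : set M) (a : R) x : I a -> N x -> ideal_act I N (a *: x).
Proof. by move=> Ia Nx N' _; apply; exists a => //; exists x. Qed.

Lemma ideal_act_min I M (N N' : set M) : submodule N' ->
  (forall (a : R) x, I a -> N x -> N' (a *: x)) -> ideal_act I N `<=` N'.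
Proof. by move=> hN' h x; apply=> // _ [a Ia [y Ny <-]]; apply: h. Qed.

Lemma ideal_act_linear I M N (f : {linear M -> N}) x :
  ideal_act I setT x -> ideal_act I setT (f x).
Proof.
have sub := @ideal_act_submodule I N setT.
apply: (ideal_act_min (N' := fun x => ideal_act I setT (f x))).
  split=> [|a u v hu hv]; first by rewrite linear0; apply: sub.1.
  by rewrite linearP; apply: sub.2.
by move=> a u Ia _; rewrite linearZ; apply: ideal_actI.
Qed.

Lemma chain_submodule M (F : set (set M)) : F !=set0 ->
  (forall X, F X -> submodule X) -> total_on F subset ->
  submodule (\bigcup_(X in F) X).
Proof.
move=> [X0 FX0] hF Ftot; split=> [|a x y [X FX Xx] [Y FY Yy]].
  by exists X0 => //; apply: (hF _ FX0).1.
have [XY|YX] := Ftot _ _ FX FY.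
- by exists Y => //; apply: (hF _ FY).2 => //; apply: XY.
- by exists X => //; apply: (hF _ FX).2 => //; apply: YX.
Qed.

Lemma maximal_left_ideal_ex I : submodule I -> ~ I 1 ->
  exists2 I' : set R^o, I `<=` I' & maximal_left_ideal I'.
Proof.
move=> hI I1.
have [||I' [II' [hI' I'1] max]] :=
    @zorn_above R^o I (fun V => submodule V /\ ~ V 1).
- by [].
- move=> F F0 Fp Ftot; split; last by move=> [X FX X1]; have [_ []] := Fp _ FX.
  by apply: chain_submodule => // X /Fp[].
exists I' => //; split=> // [I'T|C hC I'C]; first by apply: I'1; rewrite I'T.
have [C1|C1] := pselect (C 1); [right|left]; last first.
  by apply/seteqP; split=> //; apply: max.
by apply/seteqP; split=> // r _; rewrite -[r]mulr1; apply: (submZ hC r C1).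
Qed.

Lemma maximal_quotient_simple I (S : lmodType R) (p : {linear R^o -> S}) :
  maximal_left_ideal I -> range p = setT -> ker p = I -> simple_module S.
Proof.
move=> [hI InT Imax] ps pk; split.
  exists (p 1) => p1; apply: InT; apply/seteqP; split=> // r _.
  by rewrite -[r]mulr1; apply: submZ => //; rewrite -pk.
move=> N hN.
have [||NI|NT] := Imax (p @^-1` N).
- split=> [|a x y]; first by rewrite /preimage/= linear0; apply: hN.1.
  by rewrite /preimage/= linearP; apply: hN.2.
- by move=> r; rewrite -pk /preimage /ker/= => ->; apply: hN.1.
- left; apply/seteqP; split=> [s|_ ->]; last exact: hN.1.
  have [r <-] := surj_ex s ps => Npr.
  by have : (p @^-1` N) r by []; rewrite NI -pk.
- right; apply/seteqP; split=> // s _.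
  by have [r <-] := surj_ex s ps; have : setT r by []; rewrite -NT.
Qed.
End Span.

Section Semiprimary.
Variables (R S : pzRingType) (q : {rmorphism R -> S}).
Hypotheses (qs : range q = setT) (qJ : q @^-1` [set 0] = @jacobson R).
Hypothesis ssS : semisimple_ring S.
Implicit Types M N P Q K : lmodType R.

Local Notation J := (@jacobson R).
Local Notation radpow k := (ideal_exp J k).
Local Notation rad M := (@ideal_act R J M setT).

Lemma jacE (a : R^o) : J a <-> q a = 0.
Proof. by rewrite -qJ. Qed.

Lemma quotZ (a : R) (x : R^o) : q ((a *: x : R^o) : R) = q a * q (x : R).
Proof. exact: rmorphM. Qed.

Lemma jac_submodule : submodule J.
Proof.
split=> [|a x y]; first by apply/jacE; rewrite rmorph0.
move=> /jacE hx /jacE hy; apply/jacE.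
by rewrite rmorphD quotZ hx hy mulr0 addr0.
Qed.

Lemma jacMr (a b : R) : J a -> J (a * b).
Proof. by move=> /jacE qa; apply/jacE; rewrite rmorphM qa mul0r. Qed.

Lemma ideal_exp_submodule k : submodule (radpow k).
Proof. by case: k => [|k] //=; apply: ideal_act_submodule. Qed.

Lemma regZM (a b : R) (x : R^o) :
  ((a *: x : R^o) : R) * b = a *: ((x * b : R) : R^o).
Proof. exact/esym/mulrA. Qed.

Lemma ideal_expMr k (a b : R) : (radpow k) a -> (radpow k) (a * b).
Proof.
elim: k a => [//|k IH] a /=.
have sub := ideal_exp_submodule k.+1.
apply: (ideal_act_min (N' := fun x : R^o => (radpow k.+1) (x * b))).
  split=> [|r u v hu hv]; first by rewrite mul0r; apply: sub.1.
  by rewrite mulrDl regZM; apply: sub.2.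
move=> c d Jc hd; rewrite regZM; apply: ideal_actI => //; exact: IH.
Qed.

Lemma ideal_exp_jac k (a b : R) : (radpow k) a -> J b -> (radpow k.+1) (a * b).
Proof.
move=> + Jb; elim: k a => [|k IH] a.
  by move=> _; rewrite -[a * b]mulr1; apply: (@ideal_actI _ J R^o setT (a * b) 1) => //;
    apply: (submZ jac_submodule).
have sub := ideal_exp_submodule k.+2.
apply: (ideal_act_min (N' := fun x : R^o => (radpow k.+2) (x * b))).
  split=> [|r u v hu hv]; first by rewrite mul0r; apply: sub.1.
  by rewrite mulrDl regZM; apply: sub.2.
by move=> c d Jc hd; rewrite regZM; apply: ideal_actI => //; apply: IH.
Qed.

Lemma ideal_exp_pow k (a : R) : J a -> (radpow k) (a ^+ k).
Proof.
by move=> Ja; elim: k => [//|k IH]; rewrite exprSr; apply: ideal_exp_jac.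
Qed.

Lemma rad_ideal_exp k M (a : R) (x : M) :
  J a -> ideal_act (radpow k) setT x -> ideal_act (radpow k.+1) setT (a *: x).
Proof.
have sub := @ideal_act_submodule R (radpow k.+1) M setT.
move=> Ja hx; move: x hx a Ja.
apply: ideal_act_min.
  split=> [a _|r u v hu hv a Ja]; first by rewrite scaler0; apply: sub.1.
  by rewrite scalerDr scalerA; apply: (submD sub); [apply: hu; apply: jacMr|apply: hv].
move=> b y hb _ a Ja; rewrite scalerA; apply: ideal_actI => //.
exact: (@ideal_actI _ J R^o (radpow k) a b).
Qed.

Lemma ideal_exp_rad k M (a : R) (x : M) :
  (radpow k) a -> rad M x -> ideal_act (radpow k.+1) setT (a *: x).
Proof.
have sub := @ideal_act_submodule R (radpow k.+1) M setT.
move=> Ja hx; move: x hx a Ja.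
apply: ideal_act_min.
  split=> [a _|r u v hu hv a Ja]; first by rewrite scaler0; apply: sub.1.
  by rewrite scalerDr scalerA; apply: (submD sub); [apply: hu; apply: ideal_expMr|apply: hv].
move=> b y hb _ a Ja; rewrite scalerA; apply: ideal_actI => //.
exact: ideal_exp_jac.
Qed.

(** * Complements modulo the radical *)

Lemma ideal_complement (I : set R^o) : submodule I -> J `<=` I ->
  exists C : set R^o, [/\ submodule C, J `<=` C,
    forall r, I r -> C r -> J r & forall r, exists a b, [/\ I a, C b & r = a + b]].
Proof.
move=> hI JI; pose qI : set S^o := q @` I.
have hqI : submodule qI.
  split=> [|s _ _ [x Ix <-] [y Iy <-]]; first by exists 0; [apply: hI.1|rewrite rmorph0].
  have : [set: S] s by []; rewrite -qs => -[a _ <-].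
  by exists (a *: x + y); [apply: hI.2|rewrite rmorphD quotZ].
have [C [hC IC0 ICT]] := ssS hqI.
exists (q @^-1` C); split.
- split=> [|a x y]; first by rewrite /preimage/= rmorph0; apply: hC.1.
  by move=> Cx Cy; rewrite /preimage/= rmorphD quotZ; apply: hC.2.
- by move=> r /jacE qr; rewrite /preimage/= qr; apply: hC.1.
- move=> r Ir Cr; apply/jacE; have : (qI `&` C) (q r) by split=> //; exists r.
  by rewrite IC0.
- move=> r; have : [set: S^o] (q r) by [].
  rewrite -ICT => -[_ [a Ia <-] [c Cc abE]].
  exists a, (r - a); split=> //; last by rewrite addrC subrK.
  by rewrite /preimage/= rmorphB -abE addrAC subrr add0r.
Qed.

(** Every module over a semisimple ring is semisimple, for the quotient by the
    radical: a submodule [V] maximal among those that meet [U] in the radical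
    part is a complement, as for each [x] the ideal of the [r] with
    [r x] in [U + V] has a complement whose multiples of [x] can be added to
    [V]. *)
Lemma radical_complement M (U : set M) : submodule U -> rad M `<=` U ->
  exists V : set M, [/\ submodule V, rad M `<=` V,
    forall x, U x -> V x -> rad M x
    & forall x, exists u v, [/\ U u, V v & x = u + v]].
Proof.
move=> hU JU; have hJ := @ideal_act_submodule R J M setT.
have [||V [JV [hV UV] max]] := @zorn_above M (rad M)
    (fun V => submodule V /\ forall x, U x -> V x -> rad M x).
- by [].
- move=> F F0 Fp Ftot; split; last first.
    by move=> x Ux [X FX Xx]; have [_] := Fp _ FX; apply.
  by apply: chain_submodule => // X /Fp[].
exists V; split=> // x.
pose W : set M := [set w | exists u v, [/\ U u, V v & w = u + v]].
have hW : submodule W.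
  split=> [|a _ _ [u [v [Uu Vv ->]]] [u' [v' [Uu' Vv' ->]]]].
    by exists 0, 0; rewrite addr0; split=> //; [apply: hU.1|apply: hV.1].
  exists (a *: u + u'), (a *: v + v'); split; [exact: hU.2|exact: hV.2|].
  by rewrite scalerDr addrACA.
have UW u : U u -> W u by move=> Uu; exists u, 0; rewrite addr0; split=> //; apply: hV.1.
have VW v : V v -> W v by move=> Vv; exists 0, v; rewrite add0r; split=> //; apply: hU.1.
have [||C [hC JC IC ICT]] := @ideal_complement [set r | W (r *: x)].
- split=> [|a r s]; first by rewrite /= scale0r; apply: hW.1.
  by rewrite /= scalerDl -scalerA; apply: hW.2.
- by move=> r Jr; apply/UW/JU; apply: ideal_actI.
pose V' : set M := [set w | exists v (c : R), [/\ V v, C c & w = v + c *: x]].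
have VV' : V `<=` V'.
  by move=> v Vv; exists v, 0; rewrite scale0r addr0; split=> //; apply: hC.1.
have V'V : V' `<=` V.
  apply: max (VV'); split.
    split=> [|a _ _ [v [c [Vv Cc ->]]] [v' [c' [Vv' Cc' ->]]]]; first exact/VV'/hV.1.
    exists (a *: v + v'), (a * c + c'); split; [exact: hV.2|exact: hC.2|].
    by rewrite scalerDr addrACA scalerA -scalerDl.
  move=> y Uy [v [c [Vv Cc yE]]]; rewrite yE in Uy *.
  have Jc : J c.
    apply: IC => //=; have -> : c *: x = (v + c *: x) - v by rewrite addrAC subrr add0r.
    by apply: (submB hW); [apply: UW|apply: VW].
  have Vcx : V (c *: x) by apply/JV; apply: ideal_actI.
  by apply: UV => //; apply: submD.
have [a [c [Wax Cc e]]] := ICT 1.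
have : W x; last by [].
rewrite -[x]scale1r e scalerDl; apply: (submD hW) => //; apply/VW/V'V.
by exists 0, c; rewrite add0r; split=> //; apply: hV.1.
Qed.

(** * Projective covers of simple modules *)

Section Nilpotent.
Variable n0 : nat.
Hypothesis Jnil : radpow n0 = [set 0].

Lemma jac_nilpotent (a : R) : J a -> a ^+ n0 = 0.
Proof. by move/(ideal_exp_pow n0); rewrite Jnil. Qed.

(** With [d = 1 - b], the element [b^3 + 3 b^2 d] and its complement
    [d^3 + 3 d^2 b] have a product divisible by [(b d)^2], so replacing [b] by
    it squares the defect [b d] of idempotency. *)
Lemma idempotent_lift (a : R) : J (a * a - a) ->
  exists e : R, e * e = e /\ J (e - a).
Proof.
move=> Ja; have hJ := jac_submodule.
suff H k : exists b : R, [/\ J (b - a), J (b * (1 - b)) & radpow k (b * (1 - b))].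
  have [b [Jb _]] := H n0; rewrite Jnil mulrBr mulr1 => bb.
  by exists b; split=> //; apply/esym/subr0_eq.
elim: k => [|k [b [Jb Jx hx]]].
  exists a; split=> //; first by rewrite subrr; apply: hJ.1.
  by rewrite mulrBr mulr1 -opprB; apply: (submN hJ).
have [d dE] : exists d, d = 1 - b by exists (1 - b).
rewrite -dE in Jx hx.
have bd : b + d = 1 by rewrite dE addrC subrK.
have db : b * d = d * b by rewrite dE mulrBr mulrBl mulr1 mul1r.
pose u := b + d *+ 3; pose v := d + b *+ 3.
have cu w : w * b = b * w -> w * d = d * w -> w * u = u * w.
  by move=> wb wd; rewrite /u mulrDr mulrDl mulrnAr mulrnAl wb wd.
have du : d * u = u * d by apply: cu.
exists (b * b * u).
have E1 : 1 - b * b * u = d * d * v.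
  apply/eqP; rewrite subr_eq; apply/eqP.
  have -> : 1 = (b + d) ^+ 3 by rewrite bd expr1n.
  rewrite exprDn_comm // !big_ord_recr big_ord0 /= add0r !bin0 !binn.
  rewrite !expr0 !expr1 mul1r mulr1 !mulr1n /u /v !mulrDr.
  rewrite !exprS !expr0 !mulr1 !mulrA. 
  have -> : d * d * b = b * d * d by rewrite -mulrA -db mulrA -db.
  by rewrite -addrA addrC [X in X + _]addrC.
have E2 : (b * b * u) * (1 - b * b * u) = (b * d) * ((b * d) * (u * v)).
  have duK w : u * (d * w) = d * (u * w) by rewrite mulrA -du -mulrA.
  by rewrite E1 -!mulrA !duK; congr (b * _); rewrite [LHS]mulrA db -mulrA.
have hx2 : J ((b * d) * (u * v)) by apply: jacMr.
rewrite E2; split.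
- apply/jacE; rewrite rmorphB.
  have qab : q b = q a by move/jacE: Jb => /eqP; rewrite rmorphB subr_eq0 => /eqP.
  move/jacE: Jx; rewrite rmorphM => qbd.
  have qd : q d = 1 - q b by rewrite dE rmorphB rmorph1.
  have qbb : q b * q b = q b.
    by apply/esym/subr0_eq; rewrite -[X in X - _]mulr1 -mulrBr -qd.
  by rewrite !rmorphM rmorphD rmorphMn qbb mulrDr qbb mulrnAr qbd mul0rn addr0 qab subrr.
- exact: jacMr.
- exact: ideal_exp_jac.
Qed.

(** With [C] a complement of [I] modulo [J] and [1 = b + a], the component [a]
    in [C] is idempotent modulo [J]; its lift [e] generates the projective cover
    of the simple module [R / I]. *)
Lemma maximal_left_ideal_idempotent (I : set R^o) : maximal_left_ideal I ->
  exists e : R, [/\ e * e = e, I (1 - e) & forall r : R, I (r * e) -> J (r * e)].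
Proof.
move=> mI; have [hI _ _] := mI; have hJ := jac_submodule.
have JI : J `<=` I by move=> r; apply.
have [C [hC JC IC ICT]] := ideal_complement hI JI.
have [b [a [Ib Ca ba]]] := ICT 1.
have bE : b = 1 - a by rewrite ba addrK.
have Ja : J (a * a - a).
  apply: IC; last by apply: (submB hC) => //; apply: (submZ hC (a : R) Ca).
  have -> : a * a - a = - (a * b) :> R by rewrite bE mulrBr mulr1 opprB.
  by apply: (submN hI); apply: (submZ hI (a : R) Ib).
have [e [ee Je]] := idempotent_lift Ja.
exists e; split=> // [|r Ire].
  have -> : 1 - e = b - (e - a) :> R by rewrite bE opprB addrA subrK.
  by apply: (submB hI) => //; apply: JI.
have Jr : J (r * (e - a)) by apply: (submZ hJ r Je).
have -> : r * e = r * a + r * (e - a) by rewrite -mulrDr [a + _]addrC subrK.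
apply: (submD hJ) => //; apply: IC; last by apply: (submZ hC r Ca).
have -> : r * a = r * e - r * (e - a) by rewrite mulrBr subKr.
by apply: (submB hI) => //; apply: JI.
Qed.

(** Such a map factors through the image of [Q] in [P / rad P], which is a
    direct summand there. *)
Lemma extend_mod_radical Q P (Z : lmodType R) (i : {linear Q -> P})
    (f : {linear Q -> Z}) :
  injective i -> (forall x, rad P (i x) -> f x = 0) ->
  exists h : {linear P -> Z}, forall x, h (i x) = f x.
Proof.
move=> iinj fJ; have hJ := @ideal_act_submodule R J P setT.
pose U : set P := [set u | exists x z, rad P z /\ u = i x + z].
have [||V [hV JV UV UVT]] := @radical_complement P U.
- split=> [|a _ _ [x [z [Jz ->]]] [x' [z' [Jz' ->]]]].
    by exists 0, 0; rewrite linear0 addr0; split=> //; apply: hJ.1.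
  exists (a *: x + x'), (a *: z + z'); split; first exact: hJ.2.
  by rewrite linearP scalerDr addrACA.
- by move=> z Jz; exists 0, z; rewrite linear0 add0r.
have Vker x v : V v -> i x + v = 0 -> f x = 0.
  move=> Vv /eqP; rewrite addr_eq0 => /eqP ixE; apply: fJ; apply: (UV (i x)).
    by exists x, 0; rewrite addr0; split=> //; apply: hJ.1.
  by rewrite ixE; apply: submN.
have [||y [x [v [Vv /esym e <-]]]|h hE] := @linear_of_graph _ P Z
    (fun w z => exists x v, [/\ V v, w = i x + v & f x = z]).
- move=> a _ _ _ _ [x [v [Vv -> <-]]] [x' [v' [Vv' -> <-]]].
  exists (a *: x + x'), (a *: v + v'); split; first exact: hV.2.
    by rewrite linearP scalerDr addrACA.
  by rewrite linearP.
- move=> w; have [_ [v [[x [z [Jz ->]]] Vv ->]]] := UVT w.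
  exists (f x), x, (z + v); split=> //; last by rewrite addrA.
  by apply: (submD hV) => //; apply: JV.
- exact: Vker Vv e.
exists h => x; have [x' [v [Vv ixE <-]]] := hE (i x).
apply/subr0_eq; rewrite -linearB; apply: (Vker _ v Vv).
by rewrite linearB ixE opprD addrA subrr sub0r addNr.
Qed.

Lemma nilpotent_act0 M (x : M) : ideal_act (radpow n0) setT x -> x = 0.
Proof.
by rewrite Jnil; apply: (ideal_act_min (submodule0 _)) => a u /= -> _; rewrite scale0r.
Qed.

(** Successive approximation: the identity of [Q] extends to [P] up to an
    error in [J^k Q], and the error is corrected modulo [J^(k+1) Q] by
    extending it modulo the radical and lifting the result to [Q]. *)
Lemma split_of_radical_inter Q P K (i : {linear Q -> P}) (p : {linear P -> K}) :
  short_exact i p -> projective P -> (forall x, rad P (i x) -> rad Q x) ->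
  projective K.
Proof.
move=> sip Pproj hrad; have [iinj ps ik] := sip.
have H k : exists g : {linear P -> Q},
    forall y, ideal_act (radpow k) setT (g (i y) - y).
  elim: k => [|k [g gE]].
    exists \0 => y; rewrite -[_ - _]scale1r; exact: ideal_actI.
  have hk := @ideal_act_submodule R (radpow k.+1) Q setT.
  have [Z [pi [pis pik]]] := quotient_module hk.
  pose del : {linear Q -> Q} := (g \o i) \- idfun.
  have [x /hrad Jx|h hE] := @extend_mod_radical _ _ Z i (pi \o del) iinj.
    have : ker pi (del x); last by [].
    rewrite pik; move: x Jx.
    apply: (ideal_act_min (N' := fun x => ideal_act (radpow k.+1) setT (del x))).
      split=> [|a u v]; first by rewrite [del 0]linear0; apply: hk.1.
      by rewrite linearP; apply: hk.2.
    move=> a x Ja _; rewrite linearZ; apply: rad_ideal_exp => //; exact: gE.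
  have [h' h'E] := Pproj _ _ pi h pis.
  exists (g \- h') => y.
  have : ker pi (del y - h' (i y)).
    by rewrite /ker/= linearB h'E hE /= subrr.
  by rewrite pik /= addrAC.
have [g gE] := H n0.
have [|s sE] := @factor_surj _ _ _ _ p (idfun \- (i \o g)) ps.
  move=> x; rewrite -ik => -[y _ <-]; rewrite /ker/=.
  by rewrite -linearB -opprB linearN (nilpotent_act0 (gE y)) linear0 oppr0.
apply: (projective_retract (s := s) (r := p) Pproj) => x.
have [y <-] := surj_ex x ps.
by rewrite sE /= linearB (short_exact0 _ sip) subr0.
Qed.

Lemma simple_quotient_ex Q (x : Q) : ~ rad Q x ->
  exists (I : set R^o) (S0 : lmodType R) (p : {linear R^o -> S0})
      (f : {linear Q -> S0}),
    [/\ maximal_left_ideal I, range p = setT, ker p = I & f x = p 1].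
Proof.
move=> nJx; have hJ := @ideal_act_submodule R J Q setT.
pose I0 : set R^o := [set r : R^o | rad Q ((r : R) *: x)].
have [||I I0I mI] := @maximal_left_ideal_ex R I0.
- split=> [|a r s]; first by rewrite /I0/= scale0r; apply: hJ.1.
  by rewrite /I0/= scalerDl -scalerA; apply: hJ.2.
- by rewrite /I0/= scale1r.
have [hI _ _] := mI; have [S0 [p [ps pk]]] := quotient_module hI.
pose U : set Q := [set u | exists (r : R) z, rad Q z /\ u = r *: x + z].
have [||V [hV JV UV UVT]] := @radical_complement Q U.
- split=> [|a _ _ [r [z [Jz ->]]] [r' [z' [Jz' ->]]]].
    by exists 0, 0; rewrite scale0r addr0; split=> //; apply: hJ.1.
  exists (a * r + r'), (a *: z + z'); split; first exact: hJ.2.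
  by rewrite scalerDr scalerDl scalerA addrACA.
- by move=> z Jz; exists 0, z; rewrite scale0r add0r.
have Vker (r : R^o) v : V v -> (r : R) *: x + v = 0 -> p r = 0.
  move=> Vv /eqP; rewrite addr_eq0 => /eqP rxE.
  have : ker p r; last by [].
  rewrite pk; apply: I0I; apply: (UV ((r : R) *: x)).
    by exists r, 0; rewrite addr0; split=> //; apply: hJ.1.
  by rewrite rxE; apply: submN.
have [||y [r [v [Vv /esym e <-]]]|f fE] := @linear_of_graph _ Q S0
    (fun w z => exists (r : R^o) v, [/\ V v, w = (r : R) *: x + v & p r = z]).
- move=> a _ _ _ _ [r [v [Vv -> <-]]] [r' [v' [Vv' -> <-]]].
  exists ((a * r + r' : R) : R^o), (a *: v + v'); split; first exact: hV.2.
    by rewrite scalerDr scalerDl scalerA addrACA.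
  exact: (linearP p a r r').
- move=> w; have [_ [v [[r [z [Jz ->]]] Vv ->]]] := UVT w.
  exists (p r), r, (z + v); split=> //; last by rewrite addrA.
  by apply: (submD hV) => //; apply: JV.
- exact: Vker Vv e.
exists I, S0, p, f; split=> //.
have [r [v [Vv xE <-]]] := fE x.
apply/subr0_eq; rewrite -linearB; apply: (Vker _ v Vv).
by rewrite scalerBl scale1r addrAC -xE subrr.
Qed.

Lemma principal_module (e : R) : e * e = e ->
  exists (T : lmodType R) (inc : {linear T -> R^o}) (t0 : T),
    [/\ injective inc, inc t0 = e & forall y, y = (inc y : R) *: t0].
Proof.
move=> ee; have hT : submodule [set r : R^o | (r : R) * e = r].
  split=> [|a r s]; first exact: mul0r.
  by move=> /= re se; rewrite mulrDl regZM re se.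
have [T [inc [incinj incT]]] := submodule_module hT.
have : range inc (e : R^o) by rewrite incT.
case=> t0 _ t0E; exists T, inc, t0; split=> // y.
have : range inc (inc y) by exists y.
by rewrite incT /= => yE; apply: incinj; rewrite linearZ t0E; apply/esym.
Qed.

Lemma idempotent_projective_cover (I : set R^o) (e : R) (S0 T : lmodType R)
    (p : {linear R^o -> S0}) (inc : {linear T -> R^o}) (t0 : T) :
  maximal_left_ideal I -> range p = setT -> ker p = I ->
  I (1 - e) -> (forall r : R, I (r * e) -> J (r * e)) -> e * e = e ->
  injective inc -> inc t0 = e -> (forall y, y = (inc y : R) *: t0) ->
  projective_cover (p \o inc).
Proof.
move=> [hI _ _] ps pk I1e IJ ee incinj t0E tE.
have incE y : (inc y : R) * e = inc y by rewrite {2}[y]tE linearZ t0E.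
split.
- move=> A B g f gs; have [a aE] := surj_ex (f t0) gs.
  have [|h hE] := @linear_ex R T A (fun y => (inc y : R) *: a).
    by move=> r x y; rewrite linearP scalerDl -scalerA.
  by exists h => y; rewrite hE linearZ aE -linearZ -tE.
- apply/seteqP; split=> // s _; have [r <-] := surj_ex s ps.
  exists ((r : R) *: t0) => //=; rewrite linearZ t0E.
  apply/esym/subr0_eq; rewrite -linearB.
  have : ker p (r - r *: (e : R^o)); last by [].
  rewrite pk; have -> : r - r *: (e : R^o) = (r : R) *: (1 - e : R^o).
    by rewrite scalerBr; congr (_ - _); apply/esym/mulr1.
  exact: submZ.
- move=> N hN NT; have [m Nm [k kk mkE]] :
      [set x + y | x in N & y in ker (p \o inc)] t0 by rewrite NT.
  have Jk : J (inc k).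
    by rewrite -incE; apply: IJ; rewrite incE -pk.
  have Npow d : (d <= n0)%N -> N ((inc k : R) ^+ (n0 - d) *: t0).
    elim: d => [_|d IH dn].
      by rewrite subn0 jac_nilpotent // scale0r; apply: hN.1.
    rewrite -[t0]mkE scalerDr; apply: (submD hN); first exact: submZ.
    by rewrite [k in _ *: k]tE scalerA -exprSr subnSK //; apply/IH/ltnW.
  have := Npow n0 (leqnn _); rewrite subnn expr0 scale1r => Nt0.
  by apply/seteqP; split=> // y _; rewrite [y]tE; apply: submZ.
Qed.

(** The Loewy length of the cover of [S] drops because [R e] embeds in [P]
    inside the radical of [P]. *)
Lemma radical_projective_cover Q P (i : {linear Q -> P}) (x : Q) :
  injective i -> projective Q -> rad P (i x) -> ~ rad Q x ->
  exists (S0 : lmodType R) (f : {linear Q -> S0}),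
    [/\ simple_module S0, has_nonmaximal_cover S0
      & ~ exists g : {linear P -> S0}, forall y, g (i y) = f y].
Proof.
move=> iinj Qproj Jix nJx.
have [I [S0 [p [f [mI ps pk fx]]]]] := simple_quotient_ex nJx.
have [hI InT _] := mI.
have [e [ee I1e IJ]] := maximal_left_ideal_idempotent mI.
have [T [inc [t0 [incinj t0E tE]]]] := principal_module ee.
have pe1 : p (e : R^o) = p (1 : R^o).
  apply/esym/subr0_eq; rewrite -linearB.
  by have : ker p (1 - e : R^o); [rewrite pk|].
have p1 : p 1 <> 0.
  move=> p10; apply: InT; apply/seteqP; split=> // r _.
  by rewrite -[r]mulr1; apply: submZ => //; rewrite -pk.
have hJP := @ideal_act_submodule R J P setT.
have fex : f (e *: x) = p (e : R^o).
  by rewrite linearZ fx -linearZ; congr (p _); apply: mulr1.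
exists S0, f; split.
- exact: maximal_quotient_simple mI ps pk.
- have cov := idempotent_projective_cover mI ps pk I1e IJ ee incinj t0E tE.
  have incE y : (inc y : R) * e = inc y by rewrite {2}[y]tE linearZ t0E.
  exists T, (p \o inc); split=> //.
  have [_ covs _] := cov.
  have [psi psiE] := Qproj _ _ (p \o inc) f covs.
  pose w : R := inc (psi (e *: x)).
  have we : w * e = w by rewrite /w incE.
  have Jw : J (e - w).
    have -> : e - w = (e - w) * e by rewrite mulrBl ee we.
    apply: IJ; rewrite mulrBl ee we -pk /ker/=.
    rewrite (linearB p (e : R^o) (w : R^o)) /w.
    by move: (psiE (e *: x)) => /= ->; rewrite fex subrr.
  (* [y |-> y x] is injective on [R e], since [psi] inverts it up to right
     multiplication by the nilpotent [e - w]. *)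
  have inj y : (inc y : R) *: x = 0 -> y = 0.
    move=> yx0; apply: incinj; rewrite linear0.
    have incpsi (r : R) z : inc (psi (r *: z)) = r * inc (psi z) :> R.
      by rewrite !linearZ.
    have yw : (inc y : R) * w = 0.
      by rewrite /w -incpsi scalerA incE yx0 !linear0.
    have yj : (inc y : R) * (e - w) = inc y by rewrite mulrBr incE yw subr0.
    have yjk k : (inc y : R) * (e - w) ^+ k = inc y.
      by elim: k => [|k IH]; rewrite ?mulr1 // exprS mulrA yj.
    by rewrite -(yjk n0) jac_nilpotent // mulr0.
  have [||L [LE hL Lmin]] := @least_fin
      [set t | ideal_act (radpow t) [set: R^o] = [set 0]] (n0%:Z%:E).
  + apply: least_le; apply/seteqP; split; last first.
      by move=> _ ->; apply: (ideal_act_submodule _ _).1.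
    by move=> r /nilpotent_act0 ->.
  + by rewrite ltry.
  have hL0 M (z : M) : ideal_act (radpow L) setT z -> z = 0.
    apply: (ideal_act_min (submodule0 _)) => a u ha _ /=.
    have : ideal_act (radpow L) [set: R^o] ((a : R) *: (1 : R^o)) by apply: ideal_actI.
    rewrite hL /= => a1; have -> : a = 0 by rewrite -[a]mulr1.
    by rewrite scale0r.
  rewrite [loewy_length R^o]LE.
  case: L LE hL Lmin hL0 => [|L] LE hL Lmin hL0.
    exfalso; apply: p1; rewrite (_ : 1 = 0 :> R^o) ?linear0 //; apply: hL0.
    by rewrite -[1 : R^o]scale1r; apply: ideal_actI.
  have TL : ideal_act (radpow L) [set: T] = [set 0].
    apply/seteqP; split; last by move=> _ ->; apply: (ideal_act_submodule _ _).1.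
    apply: (ideal_act_min (submodule0 _)) => a y ha _ /=; apply: inj; apply: iinj.
    have -> : (inc (a *: y) : R) *: x = a *: ((inc y : R) *: x).
      by rewrite linearZ scalerA.
    rewrite linear0 linearZ; apply: hL0; apply: ideal_exp_rad => //.
    by rewrite linearZ; apply: (submZ hJP).
  move=> TLE; have : (loewy_length T <= L%:Z%:E)%E by apply: least_le.
  by rewrite TLE lee_fin lez_nat ltnn.
- case=> g gi; apply: p1; rewrite -fx -gi.
  have : rad S0 (g (i x)) by apply: ideal_act_linear.
  apply: (ideal_act_min (submodule0 _)) => a s Ja _; have [r <-] := surj_ex s ps.
  rewrite /= -linearZ; have : ker p ((a : R) *: r); last by [].
  by rewrite pk; apply: (jacMr (r : R) Ja).
Qed.


End Nilpotent.
End Semiprimary.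

(** * The global dimension *)

Theorem corollary4p5 (R : pzRingType) (hR : semiprimary R)
    (hfin : (gldim R < +oo)%E) :
  is_max0
    [set d | exists S : lmodType R,
       [/\ simple_module S, has_nonmaximal_cover S & injdim S = d]]
    (gldim R).
Proof.
have [[S [q [qs qJ ssS]]] [n0 Jnil]] := hR.
have [|n [nE pdn nmin]] := @least_fin
    [set n | forall M : lmodType R, (projdim M <= (Posz n)%:E)%E] (gldim R) _ hfin.
  by [].
rewrite -/(gldim R) in nE.
have pdle (M : lmodType R) : pd_le M n.
  have [m mn Mm] := leastP (pdn M).
  by apply/projdim_le_pd/(projdim_le_mono mn).
have idle (M : lmodType R) : injdim_le M n.
  have [C MC] := cosyzygy_ex M n.
  rewrite -[n]addn0; apply: cosyzygy_injdim_le (MC) _.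
  by apply/injective_injdim_le/(cosyzygy_injective pdle MC).
have ub (M : lmodType R) : (injdim M <= gldim R)%E by rewrite nE; apply: least_le.
case: n nE pdn nmin pdle idle => [|n] nE pdn nmin pdle idle.
  set A := [set d | _]; have [A0|/eqP/set0P[d [M [sM cM Md]]]] := pselect (A = set0).
    by right; split=> //; rewrite nE.
  left; split=> [|_ [N [_ _ <-]]]; last exact: ub.
  by exists M; split=> //; rewrite nE; apply: least_eq.
have [M npd] : exists M : lmodType R, ~ pd_le M n.
  apply: contrapT => h; suff : (n < n)%N by rewrite ltnn.
  apply: nmin => M; apply: least_le; apply: pd_projdim_le.
  by apply: contrapT => hM; apply: h; exists M.
have [Q [P [K [i [p [Qproj Pproj sip Knproj KS]]]]]] := last_syzygy (pdle M) npd.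
have [iinj _ _] := sip.
have [x [Jx nJx]] : exists x : Q, ideal_act (@jacobson R) setT (i x)
    /\ ~ ideal_act (@jacobson R) setT x.
  apply: contrapT => h; apply: Knproj.
  apply: (split_of_radical_inter qs qJ ssS Jnil sip Pproj) => x Jx.
  by apply: contrapT => nJx; apply: h; exists x.
have [S0 [f [S0simple S0cover fext]]] :=
  radical_projective_cover qs qJ ssS Jnil iinj Qproj Jx nJx.
left; split=> [|_ [N [_ _ <-]]]; last exact: ub.
exists S0; split=> //; rewrite nE; apply: least_eq => // k S0k.
rewrite ltnNge; apply/negP => kn.
have [C [S0C Cinj]] := injdim_le_cosyzygy (injdim_le_mono kn S0k).
apply: fext; apply: (KS S0 C S0C _ _ _ i p sip) => A B j r [jinj _ _] g.
exact: Cinj.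
Qed.
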